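(* Let $\mathbf A$ be a semi-Heyting algebra. Then $\mathbf A$ is anti-Boolean if and only if $\mathbf A$ satisfies (i) $(x^*\to x)^*\approx1$ and (ii) $(x\to y)\vee(y\to z)\vee(z\to x)\approx1$.
   Context: A semi-Heyting algebra is an algebra $\langle A;\wedge,\vee,\to,0,1\rangle$ such that $\langle A;\wedge,\vee,0,1\rangle$ is a bounded lattice and the identities $x\wedge(x\to y)\approx x\wedge y$, $x\wedge(y\to z)\approx x\wedge((x\wedge y)\to(x\wedge z))$, $x\to x\approx1$ hold. Write $x^*:=x\to0$. $\bar{\mathbf 2}$ is the semi-Heyting algebra on the chain $0<1$ with $0\to0=1$, $0\to1=0$, $1\to0=0$, $1\to1=1$; a semi-Heyting algebra is anti-Boolean if it belongs to the variety generated by $\bar{\mathbf 2}$. *)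

(* Defs.v *)
Record algebra := Algebra {
  carrier :> Type;
  meet : carrier -> carrier -> carrier;
  join : carrier -> carrier -> carrier;
  imp : carrier -> carrier -> carrier;
  bot : carrier;
  top : carrier }.

Arguments meet {a} x y.
Arguments join {a} x y.
Arguments imp {a} x y.
Arguments bot {a}.
Arguments top {a}.

Declare Scope algebra_scope.
Delimit Scope algebra_scope with alg.
Notation "x `&` y" := (meet x y)
  (at level 48, left associativity) : algebra_scope.
Notation "x `|` y" := (join x y)
  (at level 52, left associativity) : algebra_scope.
Notation "x ==> y" := (imp x y)
  (at level 55, right associativity) : algebra_scope.
Open Scope algebra_scope.

Definition star {A : algebra} (x : A) : A := x ==> bot.

Record bounded_lattice (A : algebra) : Prop := BoundedLattice {
  meetC : forall x y : A, x `&` y = y `&` x;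
  joinC : forall x y : A, x `|` y = y `|` x;
  meetA : forall x y z : A, x `&` (y `&` z) = (x `&` y) `&` z;
  joinA : forall x y z : A, x `|` (y `|` z) = (x `|` y) `|` z;
  meetK : forall x y : A, x `&` (x `|` y) = x;
  joinK : forall x y : A, x `|` (x `&` y) = x;
  meet_bot : forall x : A, x `&` bot = bot;
  join_top : forall x : A, x `|` top = top }.

Record semi_Heyting (A : algebra) : Prop := SemiHeyting {
  sh_lattice : bounded_lattice A;
  sh_meet_imp : forall x y : A, x `&` (x ==> y) = x `&` y;
  sh_meet_impD : forall x y z : A,
    x `&` (y ==> z) = x `&` ((x `&` y) ==> (x `&` z));
  sh_imp_refl : forall x : A, (x ==> x) = top }.

Record homomorphism {A B : algebra} (f : A -> B) : Prop := Homomorphism {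
  hom_meet : forall x y, f (x `&` y) = f x `&` f y;
  hom_join : forall x y, f (x `|` y) = f x `|` f y;
  hom_imp : forall x y, f (x ==> y) = (f x ==> f y);
  hom_bot : f bot = bot;
  hom_top : f top = top }.

Record subuniverse {A : algebra} (S : A -> Prop) : Prop := Subuniverse {
  sub_meet : forall x y, S x -> S y -> S (x `&` y);
  sub_join : forall x y, S x -> S y -> S (x `|` y);
  sub_imp : forall x y, S x -> S y -> S (x ==> y);
  sub_bot : S bot;
  sub_top : S top }.

Definition subalgebra {A : algebra} (S : A -> Prop) (HS : subuniverse S)
    : algebra :=
  let lift op (Hop : forall x y, S x -> S y -> S (op x y)) (x y : {x | S x}) :=
    exist S (op (proj1_sig x) (proj1_sig y))
      (Hop _ _ (proj2_sig x) (proj2_sig y)) in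
  {| carrier := {x : A | S x};
     meet := lift meet (sub_meet S HS);
     join := lift join (sub_join S HS);
     imp := lift imp (sub_imp S HS);
     bot := exist S bot (sub_bot S HS);
     top := exist S top (sub_top S HS) |}.

Definition product {I : Type} (F : I -> algebra) : algebra :=
  {| carrier := forall i, F i;
     meet := fun x y i => x i `&` y i;
     join := fun x y i => x i `|` y i;
     imp := fun x y i => x i ==> y i;
     bot := fun i => bot;
     top := fun i => top |}.

(* A variety is a class of algebras closed under H, S and P.  Closure under
   isomorphism is the special case of H in which the map is bijective. *)
Record variety (V : algebra -> Prop) : Prop := Variety {
  variety_H : forall (A B : algebra) (f : A -> B),
    homomorphism f -> (forall b, exists a, f a = b) -> V A -> V B;
  variety_S : forall (A : algebra) (S : A -> Prop) (HS : subuniverse S),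
    V A -> V (subalgebra S HS);
  variety_P : forall (I : Type) (F : I -> algebra),
    (forall i, V (F i)) -> V (product F) }.

(* Membership in the smallest variety containing K. *)
Definition generated_variety (K : algebra -> Prop) (A : algebra) : Prop :=
  forall V : algebra -> Prop, variety V -> (forall B, K B -> V B) -> V A.

(* The chain false < true. *)
Definition two_bar : algebra :=
  {| carrier := bool;
     meet := andb;
     join := orb;
     imp := fun x y => match x, y with
                       | false, false => true
                       | false, true => false
                       | true, false => false
                       | true, true => true
                       end;
     bot := false;
     top := true |}.

Definition anti_Boolean (A : algebra) : Prop :=
  generated_variety (fun B => B = two_bar) A.

(* Main.v *)
(** Condition (i) forces [0 -> 1 = 0] and [x* -> x = 0]; then (ii) at [1, x, 0]
    shows that the only dense element is [1], so [x \/ x* = 1] and the lattice is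
    Boolean.  Below an element [w] that decides the variables of a term (each
    variable [a] satisfies [w <= a] or [w <= a*]), the term is computed by
    [two_bar], because [w /\ (x -> y) = w /\ ((w /\ x) -> (w /\ y))].  Splitting
    [1] along [a \/ a* = 1], one variable after the other, every identity of
    [two_bar] holds in [A].  Hence [A] is a quotient of the algebra of term
    functions on [two_bar] with variables in [A], a subalgebra of a power of
    [two_bar]. *)
From Stdlib Require Import List ProofIrrelevance FunctionalExtensionality.
From Stdlib Require Import ClassicalEpsilon.
Require Import Defs.
Import ListNotations.

(** * Necessity: the two identities define a variety containing [two_bar] *)

Definition anti_Boolean_identities (A : algebra) : Prop :=
  (forall x : A, star (star x ==> x) = top) /\
  (forall x y z : A, (x ==> y) `|` (y ==> z) `|` (z ==> x) = top).

Lemma anti_Boolean_identities_variety : variety anti_Boolean_identities.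
Proof.
split.
- intros A B f [_ fj fi f0 f1] surj [Hi Hii]; split.
  + intros b; destruct (surj b) as [a <-]; unfold star.
    rewrite <- f0, <- !fi, <- f1; f_equal; apply Hi.
  + intros b c d.
    destruct (surj b) as [x <-], (surj c) as [y <-], (surj d) as [z <-].
    rewrite <- !fi, <- !fj, <- f1; f_equal; apply Hii.
- intros A S HS [Hi Hii]; split.
  + intros x; apply subset_eq_compat; apply Hi.
  + intros x y z; apply subset_eq_compat; apply Hii.
- intros I F HF; split.
  + intros x; extensionality i; apply (proj1 (HF i)).
  + intros x y z; extensionality i; apply (proj2 (HF i)).
Qed.

Lemma two_bar_identities : anti_Boolean_identities two_bar.
Proof.
split.
- intros []; reflexivity.
- intros [] [] []; reflexivity.
Qed.

(** * Distributivity and pseudocomplements in semi-Heyting algebras *)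

Section SemiHeyting.

Variables (A : algebra) (HA : semi_Heyting A).
Implicit Types a b c w x y z : A.

Let mC := meetC A (sh_lattice A HA).
Let jC := joinC A (sh_lattice A HA).
Let mA := meetA A (sh_lattice A HA).
Let jA := joinA A (sh_lattice A HA).
Let mK := meetK A (sh_lattice A HA).
Let jK := joinK A (sh_lattice A HA).
Let m0 := meet_bot A (sh_lattice A HA).
Let j1 := join_top A (sh_lattice A HA).
Let mI := sh_meet_imp A HA.
Let mID := sh_meet_impD A HA.
Let Irefl := sh_imp_refl A HA.

Lemma meet_top x : x `&` top = x.
Proof. rewrite <- (j1 x); apply mK. Qed.

Lemma join_bot x : x `|` bot = x.
Proof. rewrite <- (m0 x); apply jK. Qed.

Lemma meet_idem x : x `&` x = x.
Proof. rewrite <- (jK x x) at 2; apply mK. Qed.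

Lemma meet_eq_join x y : x `&` y = x -> x `|` y = y.
Proof. intros <-; rewrite jC, mC; apply jK. Qed.

Lemma join_eq_meet x y : x `|` y = y -> x `&` y = x.
Proof. intros <-; apply mK. Qed.

(* [x ==> x `&` c] is the relative pseudocomplement of [x] with respect to
   [c]; plain [x ==> c] is not one in a semi-Heyting algebra. *)
Lemma le_relative_pseudocomplement a x c :
  (a `&` x) `&` c = a `&` x -> a `&` (x ==> x `&` c) = a.
Proof. intros H; rewrite mID, mA, H, Irefl; apply meet_top. Qed.

(** With [c] the right-hand side, [y] and [z] both lie below [x ==> x]&[c], hence so does their
    join; meeting with [x] then gives a lower bound of [c]. *)
Lemma meet_joinr x y z : x `&` (y `|` z) = (x `&` y) `|` (x `&` z).
Proof.
set (c := (x `&` y) `|` (x `&` z)).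
assert (Hy : (x `&` y) `&` c = x `&` y) by apply mK.
assert (Hz : (x `&` z) `&` c = x `&` z) by (unfold c; rewrite jC; apply mK).
assert (Ry : y `|` (x ==> x `&` c) = (x ==> x `&` c)).
{ apply meet_eq_join, le_relative_pseudocomplement; rewrite (mC y); exact Hy. }
assert (Rz : z `|` (x ==> x `&` c) = (x ==> x `&` c)).
{ apply meet_eq_join, le_relative_pseudocomplement; rewrite (mC z); exact Hz. }
assert (Ryz : (y `|` z) `&` (x ==> x `&` c) = y `|` z).
{ apply join_eq_meet; rewrite <- jA, Rz; exact Ry. }
assert (le1 : (x `&` (y `|` z)) `&` c = x `&` (y `|` z)).
{ rewrite <- Ryz at 2; rewrite (mC (y `|` z)), mA, mI, mA, meet_idem.
  rewrite <- !mA; f_equal; apply mC. }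
(* The opposite inequality holds in every lattice. *)
assert (le2 : c `|` (x `&` (y `|` z)) = x `&` (y `|` z)).
{ unfold c; rewrite <- jA.
  rewrite (meet_eq_join (x `&` z)).
  - apply meet_eq_join.
    rewrite (mC x (y `|` z)), mA, <- (mA x y), mK, <- mA, (mC y), mA.
    rewrite meet_idem; reflexivity.
  - rewrite (mC x (y `|` z)), mA, <- (mA x z), (jC y), mK, <- mA, (mC z), mA.
    rewrite meet_idem; reflexivity. }
rewrite <- le1, mC; apply join_eq_meet; exact le2.
Qed.

Lemma meet_star x : x `&` star x = bot.
Proof. unfold star; rewrite mI; apply m0. Qed.

Lemma meet_bot_le_star a x : a `&` x = bot -> a `&` star x = a.
Proof. intros H; unfold star; rewrite mID, H, m0, Irefl; apply meet_top. Qed.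

Lemma star_top_bot x : star x = top -> x = bot.
Proof. intros H; rewrite <- (meet_top x), <- H; apply meet_star. Qed.

(** By distributivity [d] is disjoint from both [x] and [star x]; the first puts [d] below [star x],
    so the second forces [d = bot]. *)
Lemma join_star_dense x : star (x `|` star x) = bot.
Proof.
set (d := star (x `|` star x)).
assert (Hd : d `&` x `|` d `&` star x = bot)
  by (rewrite <- meet_joinr, mC; apply meet_star).
assert (Hx : d `&` x = bot).
{ rewrite <- (mK (d `&` x) (d `&` star x)), Hd; apply m0. }
rewrite Hx, jC, join_bot, (meet_bot_le_star d x Hx) in Hd; exact Hd.
Qed.

(** * Complementation from conditions (i) and (ii) *)

Hypothesis Hi : forall x, star (star x ==> x) = top.
Hypothesis Hii : forall x y z, (x ==> y) `|` (y ==> z) `|` (z ==> x) = top.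

Lemma star_top : star top = bot :> A.
Proof. rewrite <- (meet_top (star top)), mC; apply meet_star. Qed.

(** Condition (i) at [top] says that [star (bot ==> top) = top]. *)
Lemma imp_bot_top : (bot ==> top) = bot :> A.
Proof. apply star_top_bot; rewrite <- star_top at 1; apply Hi. Qed.

Lemma meet_imp_bot w : w `&` (bot ==> w) = bot.
Proof.
rewrite <- (meet_top w) at 2; rewrite <- (m0 w) at 1.
rewrite <- mID, imp_bot_top; apply m0.
Qed.

Lemma dense_top x : star x = bot -> x = top.
Proof.
intros H; rewrite <- (Hii top x bot).
change (x ==> bot) with (star x).
rewrite H, imp_bot_top, !join_bot.
(* Only [top ==> x] is left of the join, and it equals [x] by the first implication law. *)
rewrite <- (meet_top (top ==> x)), mC, mI, mC; symmetry; apply meet_top.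
Qed.

Lemma join_star x : x `|` star x = top.
Proof. apply dense_top, join_star_dense. Qed.

Lemma eq_by_cases a x y :
  a `&` x = a `&` y -> star a `&` x = star a `&` y -> x = y.
Proof.
intros H1 H2.
rewrite <- (meet_top x), <- (meet_top y), <- (join_star a), !meet_joinr.
rewrite !(mC _ a), !(mC _ (star a)), H1, H2; reflexivity.
Qed.

End SemiHeyting.

(** * Terms and valuations in [two_bar] *)

Inductive term (X : Type) : Type :=
| Var (a : X)
| Meet (t s : term X)
| Join (t s : term X)
| Imp (t s : term X)
| Bot
| Top.

Arguments Var {X} a.
Arguments Meet {X} t s.
Arguments Join {X} t s.
Arguments Imp {X} t s.
Arguments Bot {X}.
Arguments Top {X}.

Fixpoint eval {X : Type} {B : algebra} (v : X -> B) (t : term X) : B :=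
  match t with
  | Var a => v a
  | Meet t s => eval v t `&` eval v s
  | Join t s => eval v t `|` eval v s
  | Imp t s => eval v t ==> eval v s
  | Bot => bot
  | Top => top
  end.

Fixpoint vars {X : Type} (t : term X) : list X :=
  match t with
  | Var a => [a]
  | Meet t s | Join t s | Imp t s => vars t ++ vars s
  | Bot | Top => []
  end.

Definition update {X : Type} (v : X -> two_bar) (a : X) (b : bool) (x : X)
    : two_bar :=
  if excluded_middle_informative (x = a) then b else v x.

(** * Identities of [two_bar] hold in [A] *)

Section Completeness.

Variables (A : algebra) (HA : semi_Heyting A).
Hypothesis HAid : anti_Boolean_identities A.

Let mC := meetC A (sh_lattice A HA).
Let mA := meetA A (sh_lattice A HA).
Let m0 := meet_bot A (sh_lattice A HA).

Definition truth_below (w : A) (b : bool) : A := if b then w else bot.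

Definition decides {X : Type} (e : X -> A) (w : A) (v : X -> two_bar) (a : X)
    : Prop :=
  w `&` e a = truth_below w (v a).

(** Induction on [t]: relative to [w], the elements [bot] and [w] combine as [false] and [true] do
    in [two_bar]. *)
Lemma decides_eval {X : Type} (e : X -> A) (w : A) (v : X -> two_bar)
    (t : term X) :
  (forall a, In a (vars t) -> decides e w v a) ->
  w `&` eval e t = truth_below w (eval v t).
Proof.
induction t as [a|t IHt s IHs|t IHt s IHs|t IHt s IHs| |]; simpl; intros D.
- apply D; left; reflexivity.
- assert (Ht := IHt (fun a H => D a (in_or_app _ _ a (or_introl H)))).
  assert (Hs := IHs (fun a H => D a (in_or_app _ _ a (or_intror H)))).
  rewrite mA, Ht.
  destruct (eval v t); simpl; [exact Hs | rewrite mC; apply m0].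
- assert (Ht := IHt (fun a H => D a (in_or_app _ _ a (or_introl H)))).
  assert (Hs := IHs (fun a H => D a (in_or_app _ _ a (or_intror H)))).
  rewrite (meet_joinr A HA), Ht, Hs.
  destruct (eval v t), (eval v s); simpl.
  + rewrite <- (meet_top A HA w) at 2; apply (joinK A (sh_lattice A HA)).
  + apply (join_bot A HA).
  + rewrite (joinC A (sh_lattice A HA)); apply (join_bot A HA).
  + apply (join_bot A HA).
- assert (Ht := IHt (fun a H => D a (in_or_app _ _ a (or_introl H)))).
  assert (Hs := IHs (fun a H => D a (in_or_app _ _ a (or_intror H)))).
  rewrite (sh_meet_impD A HA), Ht, Hs.
  destruct (eval v t), (eval v s); simpl.
  + rewrite (sh_imp_refl A HA); apply (meet_top A HA).
  + apply (meet_star A HA).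
  (* The case [false ==> true], where [two_bar] departs from the Boolean implication; condition (i)
     enters here. *)
  + apply (meet_imp_bot A HA (proj1 HAid)).
  + rewrite (sh_imp_refl A HA); apply (meet_top A HA).
- apply m0.
- apply (meet_top A HA).
Qed.

Lemma decides_update {X : Type} (e : X -> A) (w : A) (v : X -> two_bar)
    (a : X) (b : bool) (w' : A) (x : X) :
  w' `&` w = w' -> w' `&` e a = truth_below w' b ->
  x = a \/ decides e w v x -> decides e w' (update v a b) x.
Proof.
intros le Ha D; unfold decides, update.
destruct (excluded_middle_informative (x = a)) as [-> | ne]; [exact Ha |].
destruct D as [? | Dx]; [contradiction |].
rewrite <- le at 1; rewrite <- mA, Dx.
destruct (v x); simpl; [exact le | apply m0].
Qed.

(** Induction on [U], the variables that [w] may leave undecided. *)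
Lemma meet_eval_eq {X : Type} (e : X -> A) (t s : term X) :
  (forall v : X -> two_bar, eval v t = eval v s) ->
  forall (U : list X) (w : A) (v : X -> two_bar),
    (forall a, In a (vars t ++ vars s) -> In a U \/ decides e w v a) ->
    w `&` eval e t = w `&` eval e s.
Proof.
intros Hts U; induction U as [|a U IH]; intros w v D.
- assert (D' : forall a, In a (vars t ++ vars s) -> decides e w v a)
    by (intros a Ha; destruct (D a Ha) as [[] | Da]; exact Da).
  rewrite (decides_eval e w v t), (decides_eval e w v s), Hts; trivial;
    intros a Ha; apply D', in_or_app; auto.
- assert (step : forall (w' : A) (b : bool),
    w' `&` w = w' -> w' `&` e a = truth_below w' b ->
    w' `&` eval e t = w' `&` eval e s).
  { intros w' b le Ha; apply (IH w' (update v a b)); intros x Hx.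
    (* A variable repeated in [U] stays listed and is simply split on again. *)
    destruct (classic (In x U)) as [Ux | nUx]; [left; exact Ux | right].
    apply (decides_update e w v a b w' x le Ha).
    destruct (D x Hx) as [[<- | Ux] | Dx]; auto; contradiction. }
  destruct HAid as [Hi Hii].
  apply (eq_by_cases A HA Hi Hii (e a)); rewrite !mA.
  + apply (step _ true); simpl.
    * rewrite <- mA, (meet_idem A HA); reflexivity.
    * rewrite (mC (e a)), <- mA, (meet_idem A HA); reflexivity.
  + apply (step _ false); simpl.
    * rewrite <- mA, (meet_idem A HA); reflexivity.
    * rewrite (mC (star (e a))), <- mA, (mC _ (e a)), (meet_star A HA).
      apply m0.
Qed.

Lemma two_bar_identity_holds {X : Type} (e : X -> A) (t s : term X) :
  (forall v : X -> two_bar, eval v t = eval v s) -> eval e t = eval e s.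
Proof.
intros Hts.
rewrite <- (meet_top A HA (eval e t)), <- (meet_top A HA (eval e s)).
rewrite !(mC _ top).
(* All variables start undecided, so the initial valuation is arbitrary. *)
apply (meet_eval_eq e t s Hts (vars t ++ vars s) top (fun _ => true)); auto.
Qed.

(** * [A] as a quotient of an algebra of term functions *)

Definition term_function (p : product (fun _ : A -> two_bar => two_bar))
    : Prop :=
  exists t, p = fun v => eval v t.

Lemma term_function_subuniverse : subuniverse term_function.
Proof.
split.
- intros p q [t ->] [s ->]; exists (Meet t s); reflexivity.
- intros p q [t ->] [s ->]; exists (Join t s); reflexivity.
- intros p q [t ->] [s ->]; exists (Imp t s); reflexivity.
- exists Bot; reflexivity.
- exists Top; reflexivity.
Qed.

Let T := subalgebra term_function term_function_subuniverse.

(** A representing term is chosen, then evaluated with each variable standing for itself;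
    [term_valueE] shows that the choice does not matter. *)
Definition term_value (p : T) : A :=
  eval (fun a => a)
    (proj1_sig (constructive_indefinite_description _ (proj2_sig p))).

Lemma term_valueE (p : T) (t : term A) :
  proj1_sig p = (fun v => eval v t) -> term_value p = eval (fun a => a) t.
Proof.
intros Hp; unfold term_value.
destruct (constructive_indefinite_description _ _) as [s Hs]; simpl.
apply two_bar_identity_holds; intros v.
rewrite Hp in Hs; symmetry; exact (f_equal (fun g => g v) Hs).
Qed.

Lemma term_value_homomorphism : homomorphism term_value.
Proof.
split.
- intros p q; destruct (proj2_sig p) as [t Hp], (proj2_sig q) as [s Hq].
  rewrite (term_valueE _ t Hp), (term_valueE _ s Hq).
  apply (term_valueE _ (Meet t s)), (f_equal2 meet Hp Hq).
- intros p q; destruct (proj2_sig p) as [t Hp], (proj2_sig q) as [s Hq].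
  rewrite (term_valueE _ t Hp), (term_valueE _ s Hq).
  apply (term_valueE _ (Join t s)), (f_equal2 join Hp Hq).
- intros p q; destruct (proj2_sig p) as [t Hp], (proj2_sig q) as [s Hq].
  rewrite (term_valueE _ t Hp), (term_valueE _ s Hq).
  apply (term_valueE _ (Imp t s)), (f_equal2 imp Hp Hq).
- apply (term_valueE _ Bot); reflexivity.
- apply (term_valueE _ Top); reflexivity.
Qed.

Lemma term_value_surjective (a : A) : exists p, term_value p = a.
Proof.
(* The projection at coordinate [a] is a preimage of [a]. *)
exists (exist term_function (fun v => v a) (ex_intro _ (Var a) eq_refl)).
apply (term_valueE _ (Var a)); reflexivity.
Qed.

Lemma identities_anti_Boolean : anti_Boolean A.
Proof.
intros V HV Hgen.
apply (variety_H V HV T A term_value).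
- apply term_value_homomorphism.
- apply term_value_surjective.
- apply (variety_S V HV), (variety_P V HV); intros _; apply Hgen; reflexivity.
Qed.

End Completeness.

Theorem theorem7p5 (A : algebra) (HA : semi_Heyting A) :
  anti_Boolean A <->
  (forall x : A, star (star x ==> x) = top) /\
  (forall x y z : A, (x ==> y) `|` (y ==> z) `|` (z ==> x) = top).
Proof.
split.
- intros HB; apply (HB anti_Boolean_identities).
  + apply anti_Boolean_identities_variety.
  + intros B ->; apply two_bar_identities.
- apply (identities_anti_Boolean A HA).
Qed.
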